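(* Let $k\ge1$ be an integer and let $G\in V_k\Lambda^3(\mathfrak N^4)$ be a polynomial 3-form for which all the degrees of freedom $\Sigma^{k,3}(\mathfrak N^4)$ vanish. Then $G\equiv0$.
   Context: The reference tetrahedral prism is $\mathfrak N^4=\mathfrak T^3\times\mathfrak T^1$, where $\mathfrak T^3=\{(x_1,x_2,x_3): -1\le x_i\le1,\ x_1+x_2+x_3\le-1\}$ is a tetrahedron with vertices $(1,-1,-1),(-1,1,-1),(-1,-1,1),(-1,-1,-1)$ and barycentric coordinates $\lambda_1,\dots,\lambda_4$ (in that order), and $\mathfrak T^1=[-1,1]$ (variable $x_4$) with barycentric coordinates $\nu_1,\nu_2$. It has 2 tetrahedral facets ($x_4=\pm1$) and 4 triangular-prism facets (triangular face of $\mathfrak T^3$ times $\mathfrak T^1$). $P^j(\cdot)$ are polynomials of total degree $\le j$ on the indicated set ($\{0\}$ if $j<0$), $\tilde P^j$ homogeneous of degree exactly $j$ (together with $0$); $A\times B$ of spaces means the span of products. $dP^j$ is the same polynomial space as $P^j$ (the notation only indicates that no inter-element continuity is imposed). With $y=(x_1,x_2,x_3)$ let $RT^{k-1}(\mathfrak T^3)=(P^{k-1}(\mathfrak T^3))^3\oplus\tilde P^{k-1}(\mathfrak T^3)\,y$. Then $$V_k\Lambda^3(\mathfrak N^4)=\Big([0,0,0,P^k(\mathfrak T^1)]^T\times P^{k-1}(\mathfrak T^3)\Big)\oplus\Big(P^{k-1}(\mathfrak T^1)\times\begin{bmatrix}RT^{k-1}(\mathfrak T^3)\\0\end{bmatrix}\Big).$$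 For $r=1,2,3$ let $(a,b,c,d)=(1,2,3,4),(2,3,4,1),(3,4,1,2)$ respectively, and $\Psi^{b,r}=\lambda_d$, $\mathcal N^r=\lambda_a\nabla\lambda_b\times\nabla\lambda_c+\lambda_b\nabla\lambda_c\times\nabla\lambda_a+\lambda_c\nabla\lambda_a\times\nabla\lambda_b$ (3-vectors in $x_1,x_2,x_3$, ordinary cross product in $\mathbb R^3$). Put $\vartheta^b(x_4)=\nu_1\nu_2$. Degrees of freedom $\Sigma^{k,3}(\mathfrak N^4)$ of $G$ ($n$ denotes the unit normal of the facet): - $\int_{\mathcal F}(G\cdot n)q$, $q\in P^{k-1}(\mathcal F)$, each tetrahedral facet $\mathcal F$; - $\int_{\mathcal F}(G\cdot n)q$, $q\in P^{k-1}(\mathfrak T^1)\times P^{k-1}(T)$, each triangular-prism facet $\mathcal F=T\times\mathfrak T^1$; - $\int_{\mathfrak N^4}G\cdot\Big(\sum_{r=1}^3q^r\,\Psi^{b,r}\begin{bmatrix}\mathcal N^r\\0\end{bmatrix}\Big)$, for all $q^1,q^2,q^3\in dP^{k-1}(\mathfrak T^1)\times P^{k-2}(\mathfrak T^3)$; - $\int_{\mathfrak N^4}G\cdot[0,0,0,q^4\,\vartheta^b(x_4)]^T$, $q^4\in P^{k-2}(\mathfrak T^1)\times dP^{k-1}(\mathfrak T^3)$. *)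

(* Defs.v *)
From HB Require Import structures.
From mathcomp Require Import all_boot all_order all_algebra.
From mathcomp Require Import all_classical all_reals all_analysis.
(* The notations of mpoly clash with those of MathComp-Analysis. *)
From mathcomp Require Import -(notations) mpoly.
From mathcomp Require Import ring.

Set Implicit Arguments.
Unset Strict Implicit.
Unset Printing Implicit Defensive.

Import Order.TTheory GRing.Theory Num.Theory.
Import numFieldNormedType.Exports.

Local Open Scope classical_set_scope.
Local Open Scope ring_scope.

Section Vectors.
Context {R : realType}.

Definition dot n (u v : 'rV[R]_n) : R := \sum_i u 0 i * v 0 i.

Definition cross (u v : 'rV[R]_3) : 'rV[R]_3 :=
  \row_i [:: u 0 1 * v 0 2%:R - u 0 2%:R * v 0 1;
             u 0 2%:R * v 0 0 - u 0 0 * v 0 2%:R;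
             u 0 0 * v 0 1 - u 0 1 * v 0 0]`_i.

Definition pt (y : 'rV[R]_3) (z : R) : 'rV[R]_4 := row_mx y z%:M.

Definition base (x : 'rV[R]_4) : 'rV[R]_3 := @lsubmx R 1 3 1 x.

Definition x4 (x : 'rV[R]_4) : R := x 0 ord_max.

End Vectors.

Section Integrals.
Context {R : realType}.

Local Notation leb := (@lebesgue_measure R).

Definition vec3 (u : R * R * R) : 'rV[R]_3 :=
  \row_i [:: u.1.1; u.1.2; u.2]`_i.

Definition vec4 (u : R * R * R * R) : 'rV[R]_4 := pt (vec3 u.1) u.2.

Definition integral3 (D : set 'rV[R]_3) (f : 'rV[R]_3 -> R) : R :=
  \int[((leb \x leb) \x leb)%E]_(u in vec3 @^-1` D) f (vec3 u).

Definition integral4 (D : set 'rV[R]_4) (f : 'rV[R]_4 -> R) : R :=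
  \int[(((leb \x leb) \x leb) \x leb)%E]_(u in vec4 @^-1` D) f (vec4 u).

(* Integral with respect to the 3-dimensional surface measure over the affine
   patch {a + u A : u in D} of R^4; sqrt (det (A A^T)) is the volume element of
   the parametrization (A is assumed to have rank 3). *)
Definition patch_integral (D : set 'rV[R]_3) (a : 'rV[R]_4) (A : 'M[R]_(3, 4))
    (f : 'rV[R]_4 -> R) : R :=
  Num.sqrt (\det (A *m A^T)) * integral3 D (fun u => f (a + u *m A)).

End Integrals.

Section Domains.
Context {R : realType}.

Definition T3 : set 'rV[R]_3 :=
  [set y | (forall i, -1 <= y 0 i <= 1) /\ \sum_i y 0 i <= -1].

Definition T1 : set R := [set z | -1 <= z <= 1].

Definition N4 : set 'rV[R]_4 := [set x | T3 (base x) /\ T1 (x4 x)].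

(* The vertices (1,-1,-1), (-1,1,-1), (-1,-1,1), (-1,-1,-1), numbered from 0. *)
Definition vtx (i : 'I_4) : 'rV[R]_3 :=
  \row_(j < 3) if i == j :> nat then 1 else -1.

(* Barycentric coordinates of T3; they are polynomials so that their gradients
   can be taken formally. *)
Definition bary (i : 'I_4) : mpoly 3 R :=
  if unlift ord_max i is Some j then 2^-1 *: (1 + mpolyX R (mnm1 j))
  else - 2^-1 *: (1 + \sum_(j < 3) mpolyX R (mnm1 j)).

Definition lambda (i : 'I_4) (y : 'rV[R]_3) : R := meval (fun j => y 0 j) (bary i).

Definition grad_lambda (i : 'I_4) (y : 'rV[R]_3) : 'rV[R]_3 :=
  \row_j meval (fun l => y 0 l) (mderiv j (bary i)).

Lemma lambda_vtx (i j : 'I_4) : lambda i (vtx j) = (i == j)%:R.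
Proof.
have s3 (f : 'I_3 -> R) : \sum_i f i = f 0 + f 1 + f 2%:R.
  by rewrite !big_ord_recl big_ord0 addr0 addrA; congr (f _ + f _ + f _);
     apply: val_inj.
rewrite /lambda /bary; case: unliftP => [l ->|->].
  rewrite mevalZ mevalD rmorph1 mevalXU mxE.
  have -> : (lift ord_max l == j) = (j == l :> nat).
    by rewrite -[LHS](inj_eq val_inj) /= /bump leqNgt ltn_ord eq_sym.
  by case: eqP => _; [rewrite mulVf|rewrite subrr mulr0].
rewrite mevalZ mevalD rmorph1 rmorph_sum /= s3 !mevalXU !mxE.
have -> : (ord_max == j) = (3 == j :> nat) by [].
by case: j => [[|[|[|[|//]]]]] hj /=; rewrite ?subrr; field.
Qed.

Definition nu1 (z : R) : R := (1 - z) / 2.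
Definition nu2 (z : R) : R := (1 + z) / 2.

Definition tet_facet (s : R) : set 'rV[R]_4 := [set x | T3 (base x) /\ x4 x = s].

(* [tri d] is the face of T3 opposite to the vertex d. *)
Definition tri (d : 'I_4) : set 'rV[R]_3 := [set y | T3 y /\ lambda d y = 0].

Definition prism_facet (d : 'I_4) : set 'rV[R]_4 :=
  [set x | tri d (base x) /\ T1 (x4 x)].

(* When F is a facet of N4, exactly one n satisfies this: the unit normal
   pointing out of N4. *)
Definition unit_normal (F : set 'rV[R]_4) (n : 'rV[R]_4) : Prop :=
  [/\ dot n n = 1,
      forall x y, F x -> F y -> dot n (x - y) = 0 &
      forall x y, N4 x -> F y -> dot n (x - y) <= 0].

Definition tet_integral (s : R) (f : 'rV[R]_4 -> R) : R :=
  patch_integral T3 (pt 0 s) (@row_mx R 3 3 1 1%:M 0) f.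

(* The parameters (s, t, z) range over the reference triangle times T1;
   (s, t) is sent to w0 + s (w1 - w0) + t (w2 - w0), where w0, w1, w2 are the
   vertices of the triangle [tri d]. *)
Definition ref_prism : set 'rV[R]_3 :=
  [set u | [/\ 0 <= u 0 0, 0 <= u 0 1, u 0 0 + u 0 1 <= 1 & T1 (u 0 2%:R)]].

Definition prism_integral (d : 'I_4) (f : 'rV[R]_4 -> R) : R :=
  let w (i : 'I_3) := vtx (lift d i) in
  patch_integral ref_prism (pt (w 0) 0)
    (\matrix_(i < 3) [:: pt (w 1 - w 0) 0; pt (w 2%:R - w 0) 0; pt 0 1]`_i) f.

End Domains.

Section Spaces.
Context {R : realType}.

(* Spaces of functions on a set S are represented by total functions whose
   values outside S are irrelevant. [msize] and [size] are the degree plus one,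
   and vanish exactly at the zero polynomial, so the spaces are {0} for j < 0. *)

Definition P n (j : int) (S : set 'rV[R]_n) : set ('rV[R]_n -> R) :=
  [set f | exists2 p : mpoly n R, (msize p)%:Z <= j + 1 &
           forall x, S x -> f x = meval (fun i => x 0 i) p].

Definition P_T1 (j : int) : set (R -> R) :=
  [set f | exists2 p : {poly R}, (size p)%:Z <= j + 1 &
           forall z, T1 z -> f z = p.[z]].

Definition Phom n (j : nat) (S : set 'rV[R]_n) : set ('rV[R]_n -> R) :=
  [set f | exists2 p : mpoly n R, p \is ishomog1 j mdeg &
           forall x, S x -> f x = meval (fun i => x 0 i) p].

(* A x B on T1 x S, for a space A of functions of x_4 on T1 and a space B of
   functions of y = (x_1, x_2, x_3) on S. *)
Definition tensor (V : lmodType R) (S : set 'rV[R]_3)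
    (A : set (R -> R)) (B : set ('rV[R]_3 -> V)) : set ('rV[R]_4 -> V) :=
  [set f | exists m (a : 'I_m -> R -> R) (b : 'I_m -> 'rV[R]_3 -> V),
     [/\ forall i, A (a i), forall i, B (b i) &
         forall x, S (base x) -> T1 (x4 x) ->
           f x = \sum_i a i (x4 x) *: b i (base x)]].

Definition tensorR (S : set 'rV[R]_3) (A : set (R -> R))
    (B : set ('rV[R]_3 -> R)) : set ('rV[R]_4 -> R) :=
  @tensor R^o S A B.

Definition RT (j : nat) : set ('rV[R]_3 -> 'rV[R]_3) :=
  [set g | exists (p : 'I_3 -> 'rV[R]_3 -> R) (s : 'rV[R]_3 -> R),
     [/\ forall i, P j T3 (p i), Phom j T3 s &
         forall y, T3 y -> g y = (\row_i p i y) + s y *: y]].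

Definition VLambda3 (k : nat) : set ('rV[R]_4 -> 'rV[R]_4) :=
  [set G | exists (f : 'rV[R]_4 -> R) (g : 'rV[R]_4 -> 'rV[R]_3),
     [/\ tensorR T3 (P_T1 k%:Z) (P (k%:Z - 1) T3) f,
         tensor T3 (P_T1 (k%:Z - 1)) (RT k.-1) g &
         forall x, N4 x -> G x = pt 0 (f x) + pt (g x) 0]].

End Spaces.

Section DegreesOfFreedom.
Context {R : realType}.

(* For r = 0, 1, 2, [idx r j] for j = 0, 1, 2, 3 are the indices a, b, c, d,
   all numbered from 0. *)
Definition idx (r : 'I_3) (j : nat) : 'I_4 := inZp (r + j).

Definition Psi (r : 'I_3) : 'rV[R]_3 -> R := lambda (idx r 3).

Definition NN (r : 'I_3) (y : 'rV[R]_3) : 'rV[R]_3 :=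
  let l j := lambda (idx r j) y in
  let g j := grad_lambda (idx r j) y in
  l 0%N *: cross (g 1%N) (g 2%N) + l 1%N *: cross (g 2%N) (g 0%N)
    + l 2%N *: cross (g 0%N) (g 1%N).

Definition theta (z : R) : R := nu1 z * nu2 z.

Definition dofs_vanish (k : nat) (G : 'rV[R]_4 -> 'rV[R]_4) : Prop :=
  [/\ forall s, s = 1 \/ s = -1 ->
        forall n, unit_normal (tet_facet s) n ->
        forall q, P (k%:Z - 1) (tet_facet s) q ->
        tet_integral s (fun x => dot (G x) n * q x) = 0,
      forall d n, unit_normal (prism_facet d) n ->
        forall q, tensorR (tri d) (P_T1 (k%:Z - 1)) (P (k%:Z - 1) (tri d)) q ->
        prism_integral d (fun x => dot (G x) n * q x) = 0,
      forall q : 'I_3 -> 'rV[R]_4 -> R,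
        (forall r, tensorR T3 (P_T1 (k%:Z - 1)) (P (k%:Z - 2) T3) (q r)) ->
        integral4 N4 (fun x => dot (G x)
          (\sum_r (q r x * Psi r (base x)) *: pt (NN r (base x)) 0)) = 0 &
      forall q, tensorR T3 (P_T1 (k%:Z - 2)) (P (k%:Z - 1) T3) q ->
        integral4 N4 (fun x => dot (G x) (pt 0 (q x * theta (x4 x)))) = 0].

End DegreesOfFreedom.

(* Main.v *)
Require Import Defs.
From HB Require Import structures.
From mathcomp Require Import all_boot all_order all_algebra.
From mathcomp Require Import all_classical all_reals all_analysis.
From mathcomp Require Import measurable_realfun.
From mathcomp Require Import -(notations) mpoly.
From mathcomp Require Import ring lra zify.

Set Implicit Arguments.
Unset Strict Implicit.
Unset Printing Implicit Defensive.

Import Order.TTheory GRing.Theory Num.Theory.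
Import numFieldNormedType.Exports.

Local Open Scope classical_set_scope.
Local Open Scope ring_scope.

(** Write [x = (y, z)], with [y] in the tetrahedron and [z] in [-1, 1], and
    [G = (g, f)], with [g] horizontal and [f] vertical. The two components are
    treated separately, and each time the degrees of freedom are tested against
    the weight that turns the integrand into a square. A nonnegative polynomial
    whose integral over one of the domains is zero vanishes identically
    ([ev_eq0_of_Rintegral]): it vanishes on a box by continuity, hence
    everywhere, because on every line through the centre of the box it is a
    polynomial in one variable with infinitely many zeros.

    Vertical component ([vertical_component_eq0]). On the tetrahedral facets
    [G . n] is [f] up to sign, and it is itself an admissible weight, so
    [f(y, 1) = f(y, -1) = 0]. Subtracting from each power of [z] its linear
    interpolant at the end points therefore leaves [f] unchanged and exhibits it
    as [(1 - z^2) H] with [H] in P^{k-2} x P^{k-1} ([expr_interpolation]). The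
    interior weight [H theta] has against [G] the integral of
    [((1 - z^2) H)^2 / 4], so [f = 0].

    Horizontal component ([horizontal_component_eq0]). On a prism facet [y . n]
    is constant, so the normal trace of a Raviart-Thomas field has degree at most
    [k - 1] and [G . n] is again an admissible weight. Hence every coefficient
    [g_j] of [z^j] in [g] is a Raviart-Thomas field without normal trace on the
    four planes that bound the tetrahedron. The heart of the proof is that such a
    field is a combination, with coefficients in P^{k-2}, of the three bubbles
    [Psi^r N^r] ([RT_bubble_span]). Up to a constant, [N^r] is [y - v_d], where
    [v_d] is the vertex opposite to its face ([NNE]), so that
    [Psi^r N^r] is proportional to [lambda_d (y - v_d)]. In the coordinates
    [t_i = 1 + y_i], vanishing on the coordinate faces makes the [i]-th component
    a multiple [t_i (m_i + s)], where [s y] is the homogeneous part of the field;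
    vanishing on the oblique face [L = 1 + y_1 + y_2 + y_3 = 0] gives
    [2 s = L w - sum_i t_i m_i]. Substituting, the field becomes
    [(w L t - sum_i m_i t_i (t - 2 e_i)) / 2], a combination of four bubbles with
    coefficients of degree at most [k - 2], and [L t = sum_i t_i (t - 2 e_i)]
    eliminates one of them. So [g] itself is an admissible interior weight, the
    integral of [|g|^2] is zero, and [g = 0]. *)

Local Notation ev p y := (meval (fun i => y 0 i) p).
Local Notation X := (fun i => mpolyX _ (mnm1 i)).

(** * Degrees of multivariate polynomials *)

Section Degree.
Context {n : nat} {R : realType}.
Implicit Types (p q : mpoly n R) (d : nat).

Lemma msizeD_leq p q d : (msize p <= d)%N -> (msize q <= d)%N ->
  (msize (p + q) <= d)%N.
Proof.
by move=> hp hq; apply: leq_trans (msizeD_le _ _) _; rewrite geq_max hp.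
Qed.

Lemma msizeN_leq p d : (msize p <= d)%N -> (msize (- p) <= d)%N.
Proof. by rewrite msizeN. Qed.

Lemma msizeZ_leq c p d : (msize p <= d)%N -> (msize (c *: p) <= d)%N.
Proof. exact/leq_trans/msizeZ_le. Qed.

Lemma msizeC_leq (c : R) d : (0 < d)%N -> (msize (mpolyC n c) <= d)%N.
Proof. by move=> d0; rewrite msizeC (leq_trans (leq_b1 _)). Qed.

Lemma msizeX_leq (i : 'I_n) d : (1 < d)%N -> (msize (X i : mpoly n R) <= d)%N.
Proof. by rewrite msizeX mdeg1. Qed.

Lemma msize_sum_leq (I : Type) (r : seq I) (P : pred I) (F : I -> mpoly n R) d :
  (forall i, P i -> (msize (F i) <= d)%N) ->
  (msize (\sum_(i <- r | P i) F i) <= d)%N.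
Proof.
move=> h; elim/big_rec: _ => [|i p Pi hp]; first by rewrite msize0.
by apply: msizeD_leq => //; exact: h.
Qed.

Lemma msizeM_leq p q a b : (msize p <= a.+1)%N -> (msize q <= b)%N ->
  (msize (p * q) <= a + b)%N.
Proof.
move=> hp hq; have [->|p0] := eqVneq p 0; first by rewrite mul0r msize0.
have [->|q0] := eqVneq q 0; first by rewrite mulr0 msize0.
by rewrite msizeM // -subn1 leq_subLR add1n -addSn leq_add.
Qed.

End Degree.

Lemma ev_comp n m (R : realType) (p : mpoly m R) (lq : m.-tuple (mpoly n R))
    (x : 'rV[R]_n) :
  ev (comp_mpoly lq p) x = ev p (\row_i ev (tnth lq i) x).
Proof. by rewrite comp_mpoly_meval; apply: meval_eq => i; rewrite mxE. Qed.

Section Substitution.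
Context {n m : nat} {R : realType}.
Implicit Types (p : mpoly m R).

(** Monomials are products of variables, so a property graded by a bound on the
    degree need only be checked on constants and variables, and be compatible
    with sums and with products, where the bounds add up. As [msize] is the
    degree plus one, [d.+1] bounds it when the degree is at most [d]. *)
Lemma mpoly_deg_ind (P : nat -> mpoly m R -> Prop) :
  (forall d, P d 0) ->
  (forall d c, P d (mpolyC m c)) ->
  (forall d p q, P d p -> P d q -> P d (p + q)) ->
  (forall i, P 1%N (X i)) ->
  (forall a b p q, P a p -> P b q -> P (a + b)%N (p * q)) ->
  forall d p, (msize p <= d.+1)%N -> P d p.
Proof.
move=> P0 PC PD PX PM d p hp; rewrite (mpolyE p) big_seq.
elim/big_rec: _ => [|mo q hmo hq]; first exact: P0.
apply: PD => //; have hd : (mdeg mo <= d)%N.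
  by rewrite -ltnS; apply: leq_trans hp; exact: msize_mdeg_lt.
rewrite -mul_mpolyC -(subnK hd); apply: (PM); first exact: PC.
rewrite mpolyXE_id mdegE; elim/big_rec2: _ => [|i a b _ hb].
  by rewrite -mpolyC1; exact: PC.
apply: (PM) => //; elim: (mo i) => [|e he]; first by rewrite expr0 -mpolyC1; exact: PC.
by rewrite exprS -addn1 addnC; exact: PM.
Qed.

Lemma msize_comp_affine p (lq : m.-tuple (mpoly n R)) d :
  (forall i, (msize (tnth lq i) <= 2)%N) -> (msize p <= d)%N ->
  (msize (comp_mpoly lq p) <= d)%N.
Proof.
move=> hl; case: d => [|d] hp.
  by move: hp; rewrite leqn0 msize_poly_eq0 => /eqP ->; rewrite comp_mpoly0 msize0.
elim/mpoly_deg_ind: hp => {d p} [d|d c|d p q|i|a b p q].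
- by rewrite comp_mpoly0 msize0.
- by rewrite comp_mpolyC msizeC_leq.
- by rewrite comp_mpolyD; exact: msizeD_leq.
- by rewrite comp_mpolyXU -tnth_nth.
- move=> hp hq; rewrite rmorphM /= -addnS; exact: msizeM_leq.
Qed.

End Substitution.

(** * Divisibility by the equation of a hyperplane *)

Section Hyperplane.
Context {n : nat} {R : realType}.
Implicit Types (p q l : mpoly n R) (v : 'rV[R]_n).

(** [X_i - v_i l] and [X_i] agree modulo [l], hence so do all polynomials in
    them. *)
Lemma shift_mod_affine l v p d : (msize l <= 2)%N -> (msize p <= d.+1)%N ->
  exists2 q, (msize q <= d)%N &
    p = comp_mpoly [tuple X i - v 0 i *: l | i < n] p + l * q.
Proof.
move=> hl; set lq := mktuple _ => hp.
have hlq i : (msize (tnth lq i) <= 2)%N.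
  by rewrite tnth_mktuple msizeD_leq ?msizeX_leq ?msizeN_leq ?msizeZ_leq.
suff [] : [/\ (msize p <= d.+1)%N, (msize (comp_mpoly lq p) <= d.+1)%N &
    exists2 q, (msize q <= d)%N & p = comp_mpoly lq p + l * q] by [].
elim/(@mpoly_deg_ind n R): hp => {d p} [d|d c|d p q|i|a b p q].
- rewrite comp_mpoly0 msize0; split=> //.
  by exists 0; rewrite ?msize0 // mulr0 addr0.
- rewrite comp_mpolyC msizeC_leq; split=> //.
  by exists 0; rewrite ?msize0 // mulr0 addr0.
- move=> [hp hp' [q1 h1 e1]] [hq hq' [q2 h2 e2]].
  rewrite comp_mpolyD; split; [exact: msizeD_leq..|].
  exists (q1 + q2); first exact: msizeD_leq.
  by rewrite {1}e1 {1}e2; ring.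
- have -> : comp_mpoly lq (X i) = X i - v 0 i *: l.
    by rewrite comp_mpolyXU -tnth_nth tnth_mktuple.
  split; first exact: msizeX_leq.
    by have := hlq i; rewrite tnth_mktuple.
  exists (mpolyC n (v 0 i)); first exact: msizeC_leq.
  by rewrite mulrC mul_mpolyC subrK.
- move=> [hp hp' [q1 h1 e1]] [hq hq' [q2 h2 e2]].
  rewrite rmorphM /=; split; [by rewrite -addnS; exact: msizeM_leq..|].
  exists (q1 * comp_mpoly lq q + p * q2).
    apply: msizeD_leq; last exact: msizeM_leq.
    by rewrite mulrC addnC; exact: msizeM_leq.
  transitivity ((comp_mpoly lq p + l * q1) * comp_mpoly lq q + p * (l * q2)).
    by rewrite -e1 -mulrDr -e2.
  by ring.
Qed.

(** Subtracting [l] times a transversal vector [v] projects onto the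
    hyperplane [l = 0], where [p] vanishes, so the composite polynomial in
    [shift_mod_affine] is zero. *)
Lemma affine_dvd l v p d : (msize l <= 2)%N -> (msize p <= d.+1)%N ->
  (forall x : 'rV[R]_n, ev l (x - ev l x *: v) = 0) ->
  (forall x : 'rV[R]_n, ev l x = 0 -> ev p x = 0) ->
  exists2 q, (msize q <= d)%N & forall x : 'rV[R]_n, ev p x = ev l x * ev q x.
Proof.
move=> hl hp lv pl; have [q hq e] := shift_mod_affine v hl hp.
exists q => // x; rewrite {1}e mevalD mevalM ev_comp.
rewrite [X in X + _](_ : _ = 0) ?add0r // -[RHS](pl _ (lv x)).
apply: meval_eq => i.
by rewrite !mxE tnth_mktuple mevalB mevalXU mevalZ mulrC.
Qed.

End Hyperplane.

(** * Barycentric coordinates and face fields *)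

Section Barycentric.
Context {R : realType}.
Implicit Types (y : 'rV[R]_3).

Lemma sum3 (V : nmodType) (f : 'I_3 -> V) : \sum_i f i = f 0 + f 1 + f 2%:R.
Proof.
by rewrite !big_ord_recl big_ord0 addr0 addrA; congr (f _ + f _ + f _);
   apply: val_inj.
Qed.

Lemma ord3_cases (P : 'I_3 -> Prop) : P 0 -> P 1 -> P 2%:R -> forall i, P i.
Proof.
move=> P0 P1 P2 [[|[|[|//]]]] hi.
- by rewrite (_ : Ordinal hi = 0) //; exact: val_inj.
- by rewrite (_ : Ordinal hi = 1) //; exact: val_inj.
- by rewrite (_ : Ordinal hi = 2%:R) //; exact: val_inj.
Qed.

Lemma row3P (u v : 'rV[R]_3) :
  u 0 0 = v 0 0 -> u 0 1 = v 0 1 -> u 0 2%:R = v 0 2%:R -> u = v.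
Proof. by move=> *; apply/rowP; apply: ord3_cases. Qed.

Lemma lambdaE (i : 'I_4) y :
  lambda i y = [:: (1 + y 0 0) / 2; (1 + y 0 1) / 2; (1 + y 0 2%:R) / 2;
                   - ((1 + (y 0 0 + y 0 1 + y 0 2%:R)) / 2)]`_i.
Proof.
rewrite /lambda /bary; case: unliftP => [j|] ->.
  rewrite lift_max mevalZ mevalD rmorph1 mevalXU mulrC.
  by elim/ord3_cases: j.
by rewrite mevalZ mevalD rmorph1 rmorph_sum /= sum3 !mevalXU mulNr mulrC.
Qed.

Lemma grad_lambdaE (i : 'I_4) y :
  grad_lambda i y =
  \row_(j < 3) if i == 3 :> nat then - 2^-1 else (i == j :> nat)%:R / 2.
Proof.
apply/rowP => j.
have dX (l : 'I_3) : meval (fun l => y 0 l) (mderiv j (X l)) = (l == j)%:R.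
  rewrite mderivX mnm1E; case: eqP => [->|_]; last by rewrite scale0r meval0.
  rewrite scale1r (_ : mnm_sub _ _ = @mnm0 3) ?mpolyX0 ?meval1 //.
  by apply/mnmP => l0; rewrite mnmBE subnn mnm0E.
rewrite !mxE /bary; case: unliftP => [l|] ->.
  rewrite lift_max mderivZ mderivD -mpolyC1 mderivC add0r mevalZ dX mulrC.
  by rewrite ltn_eqF.
rewrite mderivZ mderivD -mpolyC1 mderivC add0r mevalZ (raddf_sum (mderiv j)) raddf_sum.
rewrite (bigD1 j) //= dX eqxx big1 ?addr0 ?mulr1 // => l lj.
by rewrite dX (negbTE lj).
Qed.

(** Up to a constant, this is the lowest-order Raviart-Thomas field of the face
    opposite to the vertex [idx r 3]: tangential on the three other faces, which
    contain that vertex. The sign alternates because increasing [r] by one applies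
    a cyclic permutation of the four vertices, which is odd. *)
Lemma NNE (r : 'I_3) y :
  NN r y = ((-1) ^+ r / 8) *: (y - vtx (idx r 3)).
Proof.
by rewrite /NN !lambdaE !grad_lambdaE; elim/ord3_cases: r; apply: row3P;
   rewrite !mxE /=; field.
Qed.

End Barycentric.

(** * Raviart-Thomas fields without normal trace *)

Section Bubbles.
Context {R : realType}.
Implicit Types (y : 'rV[R]_3).

Lemma face_dvd (c : 'I_3) (p : mpoly 3 R) d : (msize p <= d.+1)%N ->
  (forall y, y 0 c = -1 -> ev p y = 0) ->
  exists2 q, (msize q <= d)%N & forall y, ev p y = (1 + y 0 c) * ev q y.
Proof.
move=> hp p0; pose l : mpoly 3 R := mpolyC 3 1 + X c.
have lE y : ev l y = 1 + y 0 c by rewrite mevalD mevalC mevalXU.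
have [|y|y|q hq e] := affine_dvd (l := l) (v := delta_mx 0 c) _ hp.
- by rewrite msizeD_leq ?msizeC_leq ?msizeX_leq.
- by rewrite !lE !mxE !eqxx /=; ring.
- by rewrite lE => h; apply: p0; lra.
- by exists q => // y; rewrite e lE.
Qed.

Lemma oblique_face_dvd (p : mpoly 3 R) d : (msize p <= d.+1)%N ->
  (forall y, y 0 0 + y 0 1 + y 0 2%:R = -1 -> ev p y = 0) ->
  exists2 q, (msize q <= d)%N &
    forall y, ev p y = (1 + (y 0 0 + y 0 1 + y 0 2%:R)) * ev q y.
Proof.
move=> hp p0; pose l : mpoly 3 R := mpolyC 3 1 + (X 0 + X 1 + X 2%:R).
have lE y : ev l y = 1 + (y 0 0 + y 0 1 + y 0 2%:R).
  by rewrite !mevalD mevalC !mevalXU.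
have [|y|y|q hq e] := affine_dvd (l := l) (v := delta_mx 0 0) _ hp.
- by rewrite !msizeD_leq ?msizeC_leq ?msizeX_leq.
- by rewrite !lE !mxE /=; ring.
- by rewrite lE => h; apply: p0; lra.
- by exists q => // y; rewrite e lE.
Qed.

(** With [t_i = 1 + y_i] and [L = 1 + y_1 + y_2 + y_3], the hypotheses say that
    [p_c - s] vanishes on [t_c = 0], hence is [t_c m_c], and that
    [sum_c t_c m_c + 2 s] vanishes on [L = 0], hence is [L w]. These two
    divisions are where the degree drops by one. Eliminating [p] and [s] in
    favour of [m] and [w] leaves only bubbles. *)
Lemma RT_bubble_span (p : 'I_3 -> mpoly 3 R) (s : mpoly 3 R) d :
  (forall c, (msize (p c) <= d.+1)%N) -> (msize s <= d.+1)%N ->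
  (forall c y, y 0 c = -1 -> ev (p c) y + ev s y * y 0 c = 0) ->
  (forall y, y 0 0 + y 0 1 + y 0 2%:R = -1 ->
     \sum_c (ev (p c) y + ev s y * y 0 c) = 0) ->
  exists q : 'I_3 -> mpoly 3 R, (forall r, (msize (q r) <= d)%N) /\
    forall y, (\row_c ev (p c) y) + ev s y *: y =
      \sum_r (ev (q r) y * Psi r y) *: NN r y.
Proof.
move=> hp hs face oblique.
have /choice[m hm] c : exists m, (msize m <= d)%N /\
    forall y, ev (p c) y - ev s y = (1 + y 0 c) * ev m y.
  have [||m hm e] := @face_dvd c (p c - s) d.
  - by rewrite msizeD_leq ?msizeN_leq.
  - by move=> y yc; rewrite mevalB -[RHS](face _ _ yc) yc; ring.
  - by exists m; split=> // y; rewrite -e mevalB.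
have hm1 c : (msize (m c) <= d)%N by have [] := hm c.
have pE c y : ev (p c) y = (1 + y 0 c) * ev (m c) y + ev s y.
  by have [_ <-] := hm c; ring.
have [||w hw wE] :=
    @oblique_face_dvd (\sum_c (mpolyC 3 1 + X c) * m c + 2 *: s) d.
- apply: msizeD_leq; last exact: msizeZ_leq.
  apply: msize_sum_leq => c _; rewrite -[d.+1]add1n; apply: msizeM_leq => //.
  by rewrite msizeD_leq ?msizeC_leq ?msizeX_leq.
- move=> y hy; rewrite -[RHS](oblique _ hy) !sum3 !mevalD mevalZ.
  rewrite !mevalM !mevalD !mevalC !mevalXU !pE.
  rewrite (_ : y 0 2%:R = -1 - y 0 0 - y 0 1); first by ring.
  by rewrite -hy; ring.
have sE y : ev s y = ((1 + (y 0 0 + y 0 1 + y 0 2%:R)) * ev w y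
    - (1 + y 0 0) * ev (m 0) y - (1 + y 0 1) * ev (m 1) y
    - (1 + y 0 2%:R) * ev (m 2%:R) y) / 2.
  have := wE y; rewrite sum3 !mevalD mevalZ !mevalM !mevalD !mevalC !mevalXU.
  by move=> <-; field.
(* The bubbles are [- L t / 16], [- t_1 (t - 2 e_1) / 16] and
   [t_2 (t - 2 e_2) / 16]; the one of the third vertex is eliminated by
   [L t = sum_i t_i (t - 2 e_i)]. *)
exists (fun r => [:: (- 8) *: (w - m 2%:R); (- 8) *: (m 2%:R - m 0);
                     8 *: (m 2%:R - m 1)]`_r); split.
  by elim/ord3_cases => /=; rewrite msizeZ_leq ?msizeD_leq ?msizeN_leq.
move=> y; rewrite sum3 /Psi !lambdaE !NNE.
by apply: row3P; rewrite !mxE /= !mevalZ !mevalB !pE !sE; field.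
Qed.

End Bubbles.

(** * Polynomials with vanishing integral *)

Section PolynomialZero.
Context {R : realType}.

Lemma poly_itv_eq0 (p : {poly R}) (a b : R) : a < b ->
  (forall t, a <= t <= b -> p.[t] = 0) -> p = 0.
Proof.
move=> ab p0; pose s := mkseq (fun j => a + (b - a) / j.+1%:R) (size p).
apply: (@roots_geq_poly_eq0 _ _ s); last by rewrite size_mkseq.
  apply/allP => t /mapP [j _ ->]; rewrite /root p0 //.
  have j1 : 1 <= j.+1%:R :> R by rewrite ler1n.
  rewrite lerDl divr_ge0 ?subr_ge0 ?(ltW ab) //= -lerBrDl ler_pdivrMr ?ltr0n //.
  by rewrite ler_peMr // subr_ge0 ltW.
apply: mkseq_uniq => i j /addrI /(mulfI _); rewrite subr_eq0 gt_eqF // => /(_ isT).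
by move/invr_inj/eqP; rewrite eqr_nat eqSS => /eqP.
Qed.

Lemma poly_on_line n (p : mpoly n R) (a v : 'rV[R]_n) :
  exists P : {poly R}, forall t, ev p (a + t *: v) = P.[t].
Proof.
elim/(@mpoly_deg_ind n R): (leqnSn (msize p)) => {p} [_|_ c|_ p q|i|_ _ p q].
- by exists 0 => t; rewrite meval0 horner0.
- by exists c%:P => t; rewrite mevalC hornerC.
- by move=> [P hP] [Q hQ]; exists (P + Q) => t; rewrite mevalD hP hQ hornerD.
- exists ((a 0 i)%:P + v 0 i *: 'X) => t.
  by rewrite mevalXU !mxE hornerD hornerC hornerZ hornerX mulrC.
- by move=> [P hP] [Q hQ]; exists (P * Q) => t; rewrite mevalM hP hQ hornerM.
Qed.

Definition box n (c : 'rV[R]_n) (e : R) : set 'rV[R]_n :=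
  [set x | forall i, `|x 0 i - c 0 i| < e].

Definition cube n : set 'rV[R]_n := [set x | forall i, -1 <= x 0 i <= 1].

(** On the line from the centre of the box to an arbitrary point, the polynomial
    has infinitely many zeros. *)
Lemma ev_eq0_of_box n (p : mpoly n R) (c : 'rV[R]_n) (e : R) : 0 < e ->
  (forall x, box c e x -> ev p x = 0) -> forall x : 'rV[R]_n, ev p x = 0.
Proof.
move=> e0 p0 x; have [P hP] := poly_on_line p c (x - c).
pose M := 1 + \sum_i `|x 0 i - c 0 i|.
have M1 : 1 <= M by rewrite lerDl sumr_ge0.
have M0 : 0 < M by apply: lt_le_trans M1.
suff P0 : P = 0 by rewrite -[x](subrKC c) -[x - c]scale1r hP P0 horner0.
apply: (@poly_itv_eq0 _ 0 (e / (2 * M))); first by rewrite divr_gt0 ?mulr_gt0.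
move=> t /andP [t0 te]; rewrite -hP; apply: p0 => i.
rewrite !mxE [c 0 i + _]addrC addrK normrM ger0_norm //.
have xM : `|x 0 i - c 0 i| <= M.
  by rewrite /M (bigD1 i) //= addrCA lerDl addr_ge0 // sumr_ge0.
apply: (@le_lt_trans _ _ (e / (2 * M) * M)); first exact: ler_pM.
rewrite (_ : _ * _ = e / 2); first by lra.
by field; rewrite gt_eqF.
Qed.

Lemma ev_continuous n (p : mpoly n R) (x : 'rV[R]_n) (eps : R) : 0 < eps ->
  exists2 e, 0 < e & forall y, box x e y -> `|ev p y - ev p x| < eps.
Proof.
move=> eps0; have cp : ev p y @[y --> x] --> ev p x.
  elim/(@mpoly_deg_ind n R): (leqnSn (msize p)) => {p} [_|_ c|_ p q|i|_ _ p q].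
  - by under eq_fun do rewrite meval0; rewrite meval0; exact: cvg_cst.
  - by under eq_fun do rewrite mevalC; rewrite mevalC; exact: cvg_cst.
  - by move=> hp hq; under eq_fun do rewrite mevalD; rewrite mevalD; exact: cvgD.
  - by under eq_fun do rewrite mevalXU; rewrite mevalXU; exact: coord_continuous.
  - by move=> hp hq; under eq_fun do rewrite mevalM; rewrite mevalM; exact: cvgM.
have /cvgrPdist_lt/(_ _ eps0) := cp.
move=> /nbhs_ballP [e /= e0 he]; exists e => // y hy.
rewrite distrC; apply: he; split=> // i j; rewrite ord1 /ball /= distrC; exact: hy.
Qed.

End PolynomialZero.

Section PositiveIntegral.
Context {d : measure_display} {T : measurableType d} {R : realType}.
Context (mu : {measure set T -> \bar R}).

Lemma Rintegral_gt0 (D B : set T) (f : T -> R) (c : R) :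
  measurable D -> measurable B -> B `<=` D -> (mu D < +oo)%E -> (0 < mu B)%E ->
  measurable_fun D f -> [bounded f x | x in D] ->
  (forall x, D x -> 0 <= f x) -> 0 < c -> (forall x, B x -> c <= f x) ->
  0 < \int[mu]_(x in D) f x.
Proof.
move=> mD mB BD Doo B0 mf bf f0 c0 cf; apply: fine_gt0; apply/andP; split.
  have mBf := measurable_funS mD BD mf.
  apply: (@lt_le_trans _ _ (\int[mu]_(x in B) (f x)%:E)%E); last first.
    by apply: ge0_subset_integral => //; exact/measurable_EFinP.
  apply: (@lt_le_trans _ _ (\int[mu]_(x in B) cst c%:E x)%E).
    by rewrite integral_cst // mule_gt0.
  apply: ge0_le_integral => //; last exact/measurable_EFinP.
  by move=> x _; rewrite lee_fin ltW.
have /integrableP [_] := measurable_bounded_integrable mD Doo mf bf.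
apply: le_lt_trans; apply: ge0_le_integral => //.
- exact/measurable_EFinP.
- by apply: measurableT_comp => //; exact/measurable_EFinP.
- by move=> x Dx; rewrite lee_fin ler_norm.
Qed.

End PositiveIntegral.

(** Lebesgue measure on a product enters only through two properties: boxes have
    positive measure, and the cube [-1, 1]^n has finite measure. *)
Section PolynomialIntegral.
Context {d : measure_display} {T : measurableType d} {R : realType} {n : nat}.
Context (mu : {measure set T -> \bar R}) (vec : T -> 'rV[R]_n).
Hypothesis mvec : forall i, measurable_fun setT (fun t => vec t 0 i).
Hypothesis box_gt0 : forall (x : 'rV[R]_n) e, 0 < e -> (0 < mu (vec @^-1` box x e))%E.
Hypothesis cube_fin : (mu (vec @^-1` cube (n:=n)) < +oo)%E.

Lemma ev_measurable (p : mpoly n R) : measurable_fun setT (fun t => ev p (vec t)).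
Proof.
elim/(@mpoly_deg_ind n R): (leqnSn (msize p)) => {p} [_|_ c|_ p q|i|_ _ p q].
- by under eq_fun do rewrite meval0; exact: measurable_cst.
- by under eq_fun do rewrite mevalC; exact: measurable_cst.
- by move=> hp hq; under eq_fun do rewrite mevalD; exact: measurable_funD.
- by under eq_fun do rewrite mevalXU; exact: mvec.
- by move=> hp hq; under eq_fun do rewrite mevalM; exact: measurable_funM.
Qed.

Lemma ev_le_measurable (p q : mpoly n R) :
  measurable (vec @^-1` [set x | ev p x <= ev q x]).
Proof.
have := measurable_fun_ler (ev_measurable p) (ev_measurable q).
by move=> /(_ measurableT [set true]); rewrite setTI; apply.
Qed.

Lemma forall_measurable (A : 'I_n -> set 'rV[R]_n) :
  (forall i, measurable (vec @^-1` A i)) ->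
  measurable (vec @^-1` [set x | forall i, A i x]).
Proof.
move=> mA; rewrite (_ : _ @^-1` _ = \bigcap_(i in setT) (vec @^-1` A i)).
  by apply: fin_bigcap_measurable.
by apply/seteqP; split=> t /= h i; [move=> _|]; exact: h.
Qed.

Lemma box_measurable (x : 'rV[R]_n) e : measurable (vec @^-1` box x e).
Proof.
apply: (@forall_measurable (fun i y => `|y 0 i - x 0 i| < e)) => i.
have := mvec i measurableT (measurable_ball (x 0 i) e); rewrite setTI.
congr (measurable _); apply/seteqP; split=> t /=; by rewrite /ball /= distrC.
Qed.

Lemma cube_measurable :
  measurable (vec @^-1` cube (n:=n)).
Proof.
apply: (@forall_measurable (fun i y => -1 <= y 0 i <= 1)) => i.
rewrite (_ : _ @^-1` _ = (vec @^-1` [set x | ev (mpolyC n (-1)) x <= ev (X i) x])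
    `&` (vec @^-1` [set x | ev (X i) x <= ev (mpolyC n 1) x])).
  by apply: measurableI; exact: ev_le_measurable.
by apply/seteqP; split=> t /=; rewrite !mevalC !mevalXU => /andP.
Qed.

Lemma ev_bounded (p : mpoly n R) :
  exists M, forall x : 'rV[R]_n, cube x -> `|ev p x| <= M.
Proof.
elim/(@mpoly_deg_ind n R): (leqnSn (msize p)) => {p} [_|_ c|_ p q|i|_ _ p q].
- by exists 0 => x _; rewrite meval0 normr0.
- by exists `|c| => x _; rewrite mevalC.
- move=> [M hM] [N hN]; exists (M + N) => x hx; rewrite mevalD.
  by apply: le_trans (ler_normD _ _) _; rewrite lerD ?hM ?hN.
- by exists 1 => x hx; rewrite mevalXU ler_norml.
- move=> [M hM] [N hN]; exists (M * N) => x hx; rewrite mevalM normrM.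
  by rewrite ler_pM ?hM ?hN.
Qed.

(** By continuity a nonnegative polynomial with integral zero has no positive
    value in a box inside the domain; vanishing on the box, it vanishes
    everywhere. *)
Lemma ev_eq0_of_Rintegral (D : set 'rV[R]_n) (c : 'rV[R]_n) e (p : mpoly n R) :
  measurable (vec @^-1` D) -> D `<=` cube (n:=n) ->
  0 < e -> box c e `<=` D -> (forall x, D x -> 0 <= ev p x) ->
  \int[mu]_(t in vec @^-1` D) ev p (vec t) = 0 ->
  forall x : 'rV[R]_n, ev p x = 0.
Proof.
move=> mD Dcube e0 ceD p0 int0; apply: (ev_eq0_of_box e0) => x cx.
apply/eqP; rewrite eq_le p0 ?andbT; last exact: ceD.
rewrite leNgt; apply/negP => px0.
have px2 : 0 < ev p x / 2 by rewrite divr_gt0.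
have [e1 e10 he1] := ev_continuous p x px2.
have [e2 e20 he2] : exists2 e2, 0 < e2 & box x e2 `<=` box c e.
  exists (\big[Num.min/e]_i (e - `|x 0 i - c 0 i|)).
    by apply: lt_bigmin => // i _; rewrite subr_gt0.
  move=> y hy i; have := lt_le_trans (hy i) (bigmin_le_cond _ _ (erefl : xpredT i)).
  by rewrite ltrBrDr; apply: le_lt_trans; exact: ler_distD.
pose e3 := Num.min e1 e2.
suff : 0 < \int[mu]_(t in vec @^-1` D) ev p (vec t) by rewrite int0 ltxx.
apply: (@Rintegral_gt0 _ _ _ mu _ (vec @^-1` box x e3) _ (ev p x / 2)) => //.
- exact: box_measurable.
- by move=> t ht; apply: ceD; apply: he2 => i; apply: lt_le_trans (ht i) _;
    rewrite ge_min lexx orbT.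
- apply: le_lt_trans cube_fin; apply: le_measure; rewrite ?inE //.
    exact: cube_measurable.
  by move=> t /Dcube.
- by apply: box_gt0; rewrite lt_min e10 e20.
- by apply: measurable_funS (ev_measurable p).
- have [M hM] := ev_bounded p; exists M; split; first exact: num_real.
  by move=> N MN t /Dcube ht; apply: le_trans (hM _ ht) (ltW MN).
- by move=> t /p0.
- move=> t ht; have /he1 : box x e1 (vec t).
    by move=> i; apply: lt_le_trans (ht i) _; rewrite ge_min lexx.
  by rewrite ltr_distl => /andP [+ _]; rewrite (_ : _ - _ = ev p x / 2); [exact: ltW|lra].
Qed.

End PolynomialIntegral.

(** * Boxes and cubes for the product measures *)

Section Prism.
Context {R : realType}.
Implicit Types (x : 'rV[R]_4) (y : 'rV[R]_3) (z : R).

Local Notation leb := (@lebesgue_measure R).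

Lemma ord4_cases (P : 'I_4 -> Prop) :
  (forall i : 'I_3, P (lshift 1 i)) -> P ord_max -> forall i, P i.
Proof.
move=> Pl Pm i; have [j ->|j ->] := @split_ordP 3 1 i; first exact: Pl.
by rewrite (_ : rshift 3 j = ord_max) //; apply: val_inj; rewrite /= ord1.
Qed.

Lemma pt_lshift y z (i : 'I_3) : pt y z 0 (lshift 1 i) = y 0 i.
Proof. exact: row_mxEl. Qed.

Lemma pt_max y z : pt y z 0 ord_max = z.
Proof.
rewrite (_ : ord_max = @rshift 3 1 0); last exact: val_inj.
by rewrite [LHS]row_mxEr mxE mulr1n.
Qed.

Lemma x4_pt y z : x4 (pt y z) = z.
Proof. exact: pt_max. Qed.

Lemma base_pt y z : base (pt y z) = y.
Proof. exact: row_mxKl. Qed.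

Lemma base_lshift x (i : 'I_3) : base x 0 i = x 0 (lshift 1 i).
Proof. by rewrite mxE. Qed.

Lemma pt_base_x4 x : pt (base x) (x4 x) = x.
Proof.
by apply/rowP; apply: ord4_cases => [i|]; rewrite ?pt_lshift ?pt_max ?mxE.
Qed.

Definition mu3 := ((leb \x leb) \x leb)%E.

Definition mu4 := ((leb \x leb) \x leb \x leb)%E.

Lemma mu3E (A B C : set R) : measurable A -> measurable B -> measurable C ->
  mu3 (A `*` B `*` C) = (leb A * leb B * leb C)%E.
Proof.
move=> mA mB mC; rewrite /mu3 product_measure1E //; last exact: measurableX.
by congr (_ * _)%E; exact: product_measure1E.
Qed.

Lemma leb_ball_gt0 (a e : R) : 0 < e -> (0 < leb (ball a e))%E.
Proof. by move=> e0; rewrite lebesgue_measure_ball ?lte_fin ?mulrn_wgt0 // ltW. Qed.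

Lemma leb_itv_fin : leb `[(-1)%R, 1%R]%classic \is a fin_num.
Proof. by rewrite lebesgue_measure_itv /=; case: ifP. Qed.

Lemma vec3_measurable (i : 'I_3) :
  measurable_fun setT (fun t : R * R * R => vec3 t 0 i).
Proof.
elim/ord3_cases: i; under eq_fun do rewrite mxE /=.
- exact: measurableT_comp measurable_fst measurable_fst.
- exact: measurableT_comp measurable_snd measurable_fst.
- exact: measurable_snd.
Qed.

Lemma vec4_measurable (i : 'I_4) :
  measurable_fun setT (fun t : R * R * R * R => vec4 t 0 i).
Proof.
elim/ord4_cases: i => [i|].
  under eq_fun do rewrite pt_lshift.
  exact: measurableT_comp (vec3_measurable i) measurable_fst.
under eq_fun do rewrite pt_max.
exact: measurable_snd.
Qed.

Lemma box3_gt0 y e : 0 < e -> (0 < mu3 (vec3 @^-1` box y e))%E.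
Proof.
move=> e0; rewrite (_ : _ @^-1` _ =
    ball (y 0 0) e `*` ball (y 0 1) e `*` ball (y 0 2%:R) e).
  rewrite mu3E; [|exact: measurable_ball..].
  by rewrite !mule_gt0 ?leb_ball_gt0.
apply/seteqP; split=> t.
  move=> h; move: (h 0) (h 1) (h 2%:R); rewrite /ball /= !mxE /=.
  by rewrite ![`|_ - y _ _|]distrC.
move=> [[]]; rewrite /ball /= ![`|y _ _ - _|]distrC => h0 h1 h2.
by elim/ord3_cases; rewrite mxE.
Qed.

Lemma box4_gt0 x e : 0 < e -> (0 < mu4 (vec4 @^-1` box x e))%E.
Proof.
move=> e0.
rewrite (_ : _ @^-1` _ = (vec3 @^-1` box (base x) e) `*` ball (x4 x) e).
  rewrite /mu4 product_measure1E; [|exact: box_measurable vec3_measurable _ _|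
    exact: measurable_ball].
  by apply: mule_gt0; [exact: box3_gt0|exact: leb_ball_gt0].
apply/seteqP; split=> t.
  move=> h; split=> [i|]; last by have := h ord_max; rewrite pt_max distrC.
  by have := h (lshift 1 i); rewrite pt_lshift base_lshift.
move=> [h h3]; elim/ord4_cases => [i|]; last by rewrite pt_max distrC.
by rewrite pt_lshift -base_lshift.
Qed.

Lemma cube3_fin : (mu3 (vec3 @^-1` cube (n := 3)) < +oo)%E.
Proof.
rewrite (_ : _ @^-1` _ = `[-1, 1] `*` `[-1, 1] `*` `[-1, 1]).
  by rewrite mu3E // ltey_eq !fin_numM ?leb_itv_fin.
apply/seteqP; split=> t /=; rewrite !in_itv.
  by move=> h; move: (h 0) (h 1) (h 2%:R); rewrite !mxE.
by move=> [[h0 h1] h2]; elim/ord3_cases; rewrite mxE.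
Qed.

Lemma cube4_fin : (mu4 (vec4 @^-1` cube (n := 4)) < +oo)%E.
Proof.
rewrite (_ : _ @^-1` _ = (vec3 @^-1` cube (n := 3)) `*` `[-1, 1]).
  rewrite /mu4 product_measure1E; [|exact: cube_measurable vec3_measurable|by []].
  by rewrite ltey_eq fin_numM ?leb_itv_fin // ge0_fin_numE ?cube3_fin.
apply/seteqP; split=> t /=; rewrite in_itv /=.
  move=> h; split=> [i|]; last by have := h ord_max; rewrite pt_max.
  by have := h (lshift 1 i); rewrite pt_lshift.
by move=> [h h3]; elim/ord4_cases => [i|]; rewrite ?pt_max // pt_lshift.
Qed.

End Prism.

(** * Integrals over the tetrahedron, the prism and their product *)

Section Domains.
Context {R : realType}.
Implicit Types (x : 'rV[R]_4) (y : 'rV[R]_3) (z : R).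

Lemma T1_itv : @T1 R = `[-1, 1]%classic.
Proof. by apply/seteqP; split=> z /=; rewrite in_itv. Qed.

Lemma T3_measurable : measurable ((@vec3 R) @^-1` T3).
Proof.
rewrite (_ : _ @^-1` _ = (@vec3 R) @^-1` cube (n := 3) `&`
    vec3 @^-1` [set y | ev (\sum_i X i) y <= ev (mpolyC 3 (-1)) y]).
  apply: measurableI; first exact: cube_measurable vec3_measurable.
  exact: ev_le_measurable vec3_measurable _ _.
by apply/seteqP; split=> t /=; rewrite /T3 /= raddf_sum /= !sum3 !mevalXU mevalC.
Qed.

Lemma ref_prism_measurable : measurable ((@vec3 R) @^-1` ref_prism).
Proof.
pose le p q := (@vec3 R) @^-1` [set y | ev p y <= ev q y].
pose C c := @mpolyC 3 R c; pose Y i : mpoly 3 R := X i.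
rewrite (_ : _ @^-1` _ = le (C 0) (Y 0) `&` le (C 0) (Y 1)
    `&` le (Y 0 + Y 1) (C 1) `&` (le (C (-1)) (Y 2%:R) `&` le (Y 2%:R) (C 1))).
  by repeat apply: measurableI; exact: ev_le_measurable vec3_measurable _ _.
apply/seteqP; split=> t; rewrite /le /C /Y /= ?mevalD !mevalC !mevalXU.
  by move=> [-> -> -> /andP].
by move=> [[[h0 h1] h2] /andP h3].
Qed.

Lemma N4_measurable : measurable ((@vec4 R) @^-1` N4).
Proof.
rewrite (_ : _ @^-1` _ = vec3 @^-1` T3 `*` `[-1, 1]); last first.
  by rewrite -T1_itv; apply/seteqP; split=> t; rewrite /N4 /= base_pt x4_pt.
by apply: measurableX => //; exact: T3_measurable.
Qed.

Lemma eq_integral3 D (f g : 'rV[R]_3 -> R) :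
  (forall y, D y -> f y = g y) -> integral3 D f = integral3 D g.
Proof. by move=> fg; apply: eq_Rintegral => t /[!inE] /fg. Qed.

Lemma eq_integral4 D (f g : 'rV[R]_4 -> R) :
  (forall x, D x -> f x = g x) -> integral4 D f = integral4 D g.
Proof. by move=> fg; apply: eq_Rintegral => t /[!inE] /fg. Qed.

Lemma T3_integral_eq0 (f : 'rV[R]_3 -> R) (p : mpoly 3 R) :
  (forall y, T3 y -> f y = ev p y) -> (forall y, T3 y -> 0 <= f y) ->
  integral3 T3 f = 0 -> forall y, ev p y = 0.
Proof.
move=> fp f0; rewrite (eq_integral3 fp).
(* A box around the centroid of the tetrahedron. *)
apply: (@ev_eq0_of_Rintegral _ _ _ _ mu3 vec3 vec3_measurable box3_gt0 cube3_fin
  _ (const_mx (- 2^-1)) (10%:R^-1)).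
- exact: T3_measurable.
- by move=> y [].
- by rewrite invr_gt0.
- move=> y h; have {}h i : `|y 0 i + 1 / 2| < 1 / 10.
    by have := h i; rewrite mxE opprK !div1r.
  split=> [i|]; first by have := h i; rewrite ltr_norml => /andP [h1 h2]; lra.
  by rewrite sum3; move: (h 0) (h 1) (h 2%:R); rewrite !ltr_norml; lra.
- by move=> y hy; rewrite -fp // f0.
Qed.

Lemma ref_prism_integral_eq0 (f : 'rV[R]_3 -> R) (p : mpoly 3 R) :
  (forall y, ref_prism y -> f y = ev p y) -> (forall y, ref_prism y -> 0 <= f y) ->
  integral3 ref_prism f = 0 -> forall y, ev p y = 0.
Proof.
move=> fp f0; rewrite (eq_integral3 fp).
apply: (@ev_eq0_of_Rintegral _ _ _ _ mu3 vec3 vec3_measurable box3_gt0 cube3_fin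
  _ (const_mx (4^-1)) (10%:R^-1)).
- exact: ref_prism_measurable.
- move=> y [h0 h1 h2 h3]; elim/ord3_cases => //; lra.
- by rewrite invr_gt0.
- move=> y h; have {}h i : `|y 0 i - 1 / 4| < 1 / 10.
    by have := h i; rewrite mxE !div1r.
  move: (h 0) (h 1) (h 2%:R); rewrite !ltr_norml => h0 h1 h2.
  by split; rewrite /T1 /=; lra.
- by move=> y hy; rewrite -fp // f0.
Qed.

Lemma N4_integral_eq0 (f : 'rV[R]_4 -> R) (p : mpoly 4 R) :
  (forall x, N4 x -> f x = ev p x) -> (forall x, N4 x -> 0 <= f x) ->
  integral4 N4 f = 0 -> forall x : 'rV[R]_4, ev p x = 0.
Proof.
move=> fp f0; rewrite (eq_integral4 fp).
apply: (@ev_eq0_of_Rintegral _ _ _ _ mu4 vec4 vec4_measurable box4_gt0 cube4_fin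
  _ (const_mx (- 2^-1)) (10%:R^-1)).
- exact: N4_measurable.
- move=> x [[h _] h3]; elim/ord4_cases => [i|//]; rewrite -base_lshift; exact: h.
- by rewrite invr_gt0.
- move=> x h; have {}h i : `|x 0 i + 1 / 2| < 1 / 10.
    by have := h i; rewrite mxE opprK !div1r.
  have h' i : - (1 / 10) < base x 0 i + 1 / 2 < 1 / 10.
    by rewrite base_lshift -ltr_norml.
  split; last by have := h ord_max; rewrite /T1 /= -/(x4 x) ltr_norml; lra.
  split=> [i|]; first by have := h' i; lra.
  by rewrite sum3; move: (h' 0) (h' 1) (h' 2%:R); lra.
- by move=> x hx; rewrite -fp // f0.
Qed.

End Domains.

(** * Facets: unit normals and traces *)

Section Facets.
Context {R : realType}.
Implicit Types (x n : 'rV[R]_4) (y : 'rV[R]_3) (z : R).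

Lemma dot_base_x4 (u v : 'rV[R]_4) :
  dot u v = dot (base u) (base v) + x4 u * x4 v.
Proof.
rewrite /dot big_ord_recr /=; congr (_ + _); apply: eq_bigr => i _.
by rewrite !base_lshift; congr (u 0 _ * v 0 _); exact: val_inj.
Qed.

Lemma dot3E (u v : 'rV[R]_3) :
  dot u v = u 0 0 * v 0 0 + u 0 1 * v 0 1 + u 0 2%:R * v 0 2%:R.
Proof. exact: sum3. Qed.

Lemma ptD y y' z z' : pt (y + y') (z + z') = pt y z + pt y' z'.
Proof.
apply/rowP; apply: ord4_cases => [i|].
  by rewrite [RHS]mxE !pt_lshift mxE.
by rewrite [RHS]mxE !pt_max.
Qed.

Lemma ptZ c y z : pt (c *: y) (c * z) = c *: pt y z.
Proof.
apply/rowP; apply: ord4_cases => [i|].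
  by rewrite [RHS]mxE !pt_lshift mxE.
by rewrite [RHS]mxE !pt_max.
Qed.

Lemma unit_normal_tet (s : R) : s = 1 \/ s = -1 -> unit_normal (tet_facet s) (pt 0 s).
Proof.
have d0 x : dot (pt 0 s) x = s * x4 x.
  by rewrite dot_base_x4 base_pt x4_pt dot3E !mxE !mul0r !add0r.
have x4B x (y : 'rV[R]_4) : x4 (x - y) = x4 x - x4 y by rewrite /x4 !mxE.
move=> hs; split=> [|x y|x y].
- by rewrite d0 x4_pt; case: hs => ->; ring.
- by move=> [_ xs] [_ ys]; rewrite d0 x4B xs ys subrr mulr0.
- move=> [_ xs] [_ ys]; rewrite d0 x4B ys; move: xs; rewrite /T1 /=.
  by case: hs => ->; lra.
Qed.

Lemma tet_integralE s (f : 'rV[R]_4 -> R) :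
  tet_integral s f = integral3 T3 (fun y => f (pt y s)).
Proof.
rewrite /tet_integral /patch_integral.
have AA : row_mx 1%:M 0 *m (row_mx 1%:M 0 : 'M[R]_(3, 3 + 1))^T = 1%:M.
  by rewrite tr_row_mx mul_row_col trmx0 mulmx0 addr0 trmx1 mulmx1.
rewrite [X in \det X]AA det1 sqrtr1 mul1r.
apply: eq_integral3 => y _; congr f; apply/rowP.
rewrite [y *m _](@mul_mx_row R 1 3 3 1) mulmx1 mulmx0.
apply: ord4_cases => [i|]; rewrite mxE.
  by rewrite !pt_lshift [X in _ + X]row_mxEl mxE add0r.
by rewrite !pt_max (_ : ord_max = @rshift 3 1 0) ?[X in _ + X]row_mxEr ?mxE ?addr0 //;
  exact: val_inj.
Qed.

(** The vertical component on the facet is used as a weight against itself; the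
    factor [s] compensates for the direction of the normal. *)
Lemma tet_facet_trace_eq0 k (G : 'rV[R]_4 -> 'rV[R]_4) s (b : mpoly 3 R) :
  s = 1 \/ s = -1 -> (msize b <= k)%N ->
  (forall y, T3 y -> x4 (G (pt y s)) = ev b y) ->
  (forall n, unit_normal (tet_facet s) n ->
     forall q, P (k%:Z - 1) (tet_facet s) q ->
     tet_integral s (fun x => dot (G x) n * q x) = 0) ->
  forall y, ev b y = 0.
Proof.
move=> hs hb Gb dof y; apply/eqP; rewrite -sqrf_eq0 expr2 -mevalM; apply/eqP.
have Pq : P (k%:Z - 1) (tet_facet s) (fun x => s * ev b (base x)).
  exists (s *: comp_mpoly [tuple X (lshift 1 i) | i < 3] b).
    rewrite subrK lez_nat; apply/msizeZ_leq/msize_comp_affine => // i.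
    by rewrite tnth_mktuple msizeX_leq.
  move=> x _; rewrite mevalZ ev_comp; congr (_ * _); apply: meval_eq => i.
  by rewrite mxE tnth_mktuple mevalXU base_lshift.
have := dof _ (unit_normal_tet hs) _ Pq; rewrite tet_integralE.
have e (z : 'rV[R]_3) : T3 z ->
    dot (G (pt z s)) (pt 0 s) * (s * ev b (base (pt z s))) = ev (b * b) z.
  move=> Tz; rewrite dot_base_x4 !base_pt x4_pt Gb // dot3E !mxE !mulr0 !add0r mevalM.
  by case: hs => ->; ring.
move=> h; apply: (T3_integral_eq0 e _ h) => z Tz.
by rewrite e // mevalM -expr2 sqr_ge0.
Qed.

(** The outward direction normal to the face of the tetrahedron opposite to the
    vertex [d]; it has unit length unless that face is the oblique one. *)
Definition face_dir (d : 'I_4) : 'rV[R]_3 :=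
  \row_i if d == 3 :> nat then 1 else - (d == i :> nat)%:R.

Definition face_scale (d : 'I_4) : R := if d == 3 :> nat then (Num.sqrt 3)^-1 else 1.

Lemma face_scale_gt0 d : 0 < face_scale d.
Proof. by rewrite /face_scale; case: ifP => // _; rewrite invr_gt0 sqrtr_gt0. Qed.

(** Up to a positive factor, the outward normal is minus the gradient of [lambda d]. *)
Lemma face_dir_lambda (d : 'I_4) (u v : 'rV[R]_3) :
  dot (u - v) (face_dir d) = - 2 * (lambda d u - lambda d v).
Proof.
by rewrite dot3E !lambdaE; case: d => [[|[|[|[|//]]]] hd]; rewrite !mxE /=; field.
Qed.

Lemma lambda_ge0 (d : 'I_4) y : T3 y -> 0 <= lambda d y.
Proof.
move=> [h]; rewrite sum3 lambdaE; move: (h 0) (h 1) (h 2%:R).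
by case: d => [[|[|[|[|//]]]] hd] /=; lra.
Qed.

Lemma unit_normal_prism d :
  unit_normal (prism_facet d) (pt (face_scale d *: face_dir d) 0).
Proof.
have dn (u v : 'rV[R]_4) : dot (pt (face_scale d *: face_dir d) 0) (u - v) =
    - 2 * face_scale d * (lambda d (base u) - lambda d (base v)).
  rewrite -mulrA mulrCA -face_dir_lambda dot_base_x4 base_pt x4_pt !dot3E !mxE.
  by ring.
have c0 := face_scale_gt0 d.
split=> [|x y|x y].
- rewrite dot_base_x4 base_pt x4_pt dot3E /face_scale.
  case: d {dn c0} => [[|[|[|[|//]]]] hd]; rewrite !mxE /=; [ring..|].
  have cc : (Num.sqrt 3)^-1 * (Num.sqrt 3)^-1 = 3^-1 :> R.
    by rewrite -invfM -expr2 sqr_sqrtr.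
  by rewrite !mulr1 cc; lra.
- by move=> [[_ lx] _] [[_ ly] _]; rewrite dn lx ly subrr mulr0.
- move=> [Tx _] [[_ ly] _]; rewrite dn ly subr0 !mulNr oppr_le0.
  by apply: mulr_ge0; [rewrite mulr_ge0 // ltW|exact: lambda_ge0].
Qed.

(** [u] holds the parameters of the reference prism, the third of which is the
    height [x4] and does not move the point of the face. *)
Definition face_param (d : 'I_4) (u : 'rV[R]_3) : 'rV[R]_3 :=
  let w i := vtx (lift d i) in
  w 0 + u 0 0 *: (w 1 - w 0) + u 0 1 *: (w 2%:R - w 0).

Lemma face_param_tri (d : 'I_4) (u : 'rV[R]_3) : ref_prism u -> tri d (face_param d u).
Proof.
move=> [h0 h1 h2 _]; rewrite /face_param; set a := u 0 0 in h0 h2 *; set b := u 0 1 in h1 h2 *.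
split; [split|].
- by case: d => [[|[|[|[|//]]]] hd]; elim/ord3_cases; rewrite !mxE /bump /=; lra.
- by rewrite sum3; case: d => [[|[|[|[|//]]]] hd]; rewrite !mxE /bump /=; lra.
- by rewrite lambdaE; case: d => [[|[|[|[|//]]]] hd]; rewrite !mxE /bump /=; lra.
Qed.

(** Barycentric coordinates give the parameters of every point of the plane. *)
Lemma face_param_surj (d : 'I_4) y : lambda d y = 0 ->
  y = face_param d (\row_i [:: lambda (lift d 1) y; lambda (lift d 2%:R) y; 0]`_i).
Proof.
rewrite /face_param [_ 0 0]mxE [_ 0 1]mxE /= !lambdaE.
by case: d => [[|[|[|[|//]]]] hd] /= h; apply: row3P; rewrite !mxE /bump /=; lra.
Qed.

Lemma det3 (M : 'M[R]_3) :
  \det M = M 0 0 * (M 1 1 * M 2%:R 2%:R - M 1 2%:R * M 2%:R 1)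
    - M 0 1 * (M 1 0 * M 2%:R 2%:R - M 1 2%:R * M 2%:R 0)
    + M 0 2%:R * (M 1 0 * M 2%:R 1 - M 1 1 * M 2%:R 0).
Proof.
pose f (i j : nat) := M (inord i) (inord j).
have fE (i j : 'I_3) : M i j = f i j by rewrite /f !inord_val.
rewrite (expand_det_row _ 0) !big_ord_recl big_ord0 /cofactor.
rewrite !(expand_det_row _ ord0) !big_ord_recl !big_ord0 /cofactor !det_mx11.
by rewrite !mxE !fE /= /bump /=; ring.
Qed.

(** Only the positivity of the surface element matters. It is the root of a Gram
    determinant, positive because the edges of the prism are independent. *)
Lemma prism_integralE (d : 'I_4) (f : 'rV[R]_4 -> R) :
  exists2 c, 0 < c &
    prism_integral d f = c * integral3 ref_prism (fun u => f (pt (face_param d u) (u 0 2%:R))).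
Proof.
rewrite /prism_integral; set A := \matrix_i _.
have A0 : row 0 A = pt (vtx (lift d 1) - vtx (lift d 0)) 0 by rewrite rowK.
have A1 : row 1 A = pt (vtx (lift d 2%:R) - vtx (lift d 0)) 0 by rewrite rowK.
have A2 : row 2%:R A = pt 0 1 by rewrite rowK.
have AE i j : (A *m A^T) i j = dot (row i A) (row j A).
  by rewrite mxE; apply: eq_bigr => l _; rewrite !mxE.
exists (Num.sqrt (\det (A *m A^T))).
  rewrite sqrtr_gt0 det3 !AE A0 A1 A2 !dot_base_x4 !base_pt !x4_pt !dot3E.
  by case: d {A A0 A1 A2 AE} => [[|[|[|[|//]]]] hd]; rewrite !mxE /bump /=; lra.
congr (_ * _); apply: eq_integral3 => u _; congr f.
rewrite mulmx_sum_row sum3 A0 A1 A2 -!ptZ -!ptD /face_param.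
by congr pt; [rewrite scaler0 addr0 !addrA | rewrite !mulr0 mulr1 !add0r].
Qed.

End Facets.

Section PrismFacets.
Context {R : realType}.
Implicit Types (x n : 'rV[R]_4) (y : 'rV[R]_3) (z : R).

(** The hypothesis on [t] says that the normal trace on the facet is
    [sum_j z^j t_j(y)]; it is used as a weight against itself. The conclusion is
    about the whole plane of the face, not only about the face, because the pulled
    back trace is a polynomial that vanishes identically. *)
Lemma prism_facet_trace_eq0 k (G : 'rV[R]_4 -> 'rV[R]_4) (d : 'I_4)
    (t : nat -> mpoly 3 R) :
  (forall j, (msize (t j) <= k)%N) ->
  (forall y z, tri d y -> T1 z ->
     dot (G (pt y z)) (pt (face_dir d) 0) = \sum_(j < k) z ^+ j * ev (t j) y) ->
  (forall n, unit_normal (prism_facet d) n ->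
     forall q, tensorR (tri d) (P_T1 (k%:Z - 1)) (P (k%:Z - 1) (tri d)) q ->
     prism_integral d (fun x => dot (G x) n * q x) = 0) ->
  forall j y, (j < k)%N -> lambda d y = 0 -> ev (t j) y = 0.
Proof.
move=> ht Gt dof; set q := fun x => \sum_(j < k) x4 x ^+ j * ev (t j) (base x).
have tq : tensorR (tri d) (P_T1 (k%:Z - 1)) (P (k%:Z - 1) (tri d)) q.
  exists k, (fun j z => z ^+ j), (fun j y => ev (t j) y); split=> // j.
    by exists 'X^j => [|z _]; rewrite ?subrK ?lez_nat ?size_polyXn // hornerXn.
  by exists (t j) => //; rewrite subrK lez_nat.
pose w i : 'rV[R]_3 := vtx (lift d i).
pose lq := [tuple mpolyC 3 (w 0 0 i) + (w 1 - w 0) 0 i *: X 0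
                  + (w 2%:R - w 0) 0 i *: X 1 | i < 3].
pose S := \sum_(j < k) X 2%:R ^+ j * comp_mpoly lq (t j).
have SE (u : 'rV[R]_3) :
    ev S u = \sum_(j < k) u 0 2%:R ^+ j * ev (t j) (face_param d u).
  rewrite raddf_sum; apply: eq_bigr => j _ /=.
  rewrite mevalM rmorphXn /= mevalXU ev_comp; congr (_ * _); apply: meval_eq => i.
  rewrite mxE tnth_mktuple !mevalD !mevalZ mevalC !mevalXU /face_param.
  by rewrite !mxE; ring.
have c0 := @face_scale_gt0 R d.
have [c1 c10 hint] := prism_integralE d
  (fun x => dot (G x) (pt (face_scale d *: face_dir d) 0) * q x).
have e (u : 'rV[R]_3) : ref_prism u ->
    dot (G (pt (face_param d u) (u 0 2%:R))) (pt (face_scale d *: face_dir d) 0)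
      * q (pt (face_param d u) (u 0 2%:R)) = ev (face_scale d *: (S * S)) u.
  move=> hu; have hT : T1 (u 0 2%:R) by case: hu.
  have -> : pt (@face_scale R d *: face_dir d) 0 = face_scale d *: pt (face_dir d) 0.
    by rewrite -ptZ mulr0.
  have dZ a (v v' : 'rV[R]_4) : dot v (a *: v') = a * dot v v'.
    by rewrite /dot mulr_sumr; apply: eq_bigr => i _; rewrite mxE mulrCA.
  rewrite dZ Gt //; last exact: face_param_tri.
  by rewrite /q x4_pt base_pt mevalZ mevalM SE mulrA.
have := dof _ (unit_normal_prism d) _ tq; rewrite hint.
move/eqP; rewrite mulf_eq0 (gt_eqF c10) /= => /eqP int0.
have S0 (u : 'rV[R]_3) : ev S u = 0.
  have F0 : ev (face_scale d *: (S * S)) u = 0.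
    apply: (ref_prism_integral_eq0 e _ int0) => v hv.
    by rewrite e // mevalZ mevalM mulr_ge0 ?(ltW c0) // -expr2 sqr_ge0.
  move/eqP: F0; rewrite mevalZ mevalM -expr2 mulf_eq0 (gt_eqF c0) sqrf_eq0 /=.
  by move/eqP.
move=> j y jk ly; pose P := \poly_(j < k) ev (t j) y.
have -> : ev (t j) y = P`_j by rewrite coef_poly jk.
suff -> : P = 0 by rewrite coef0.
apply: (@poly_itv_eq0 R P 0 1) => [|z _]; first exact: ltr01.
rewrite horner_poly.
rewrite -[RHS](S0 (\row_i [:: lambda (lift d 1) y; lambda (lift d 2%:R) y; z]`_i)) SE.
apply: eq_bigr => i _; rewrite mulrC mxE /=; congr (_ * _).
apply: meval_eq => c; congr ((_ : 'rV[R]_3) 0 c).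
rewrite {1}(face_param_surj ly) /face_param.
by rewrite ![(\row_i _) _ _]mxE.
Qed.

End PrismFacets.

(** * Expansion of tensor product spaces in powers of x4 *)

Section NormalForms.
Context {R : realType}.
Implicit Types (x : 'rV[R]_4) (y : 'rV[R]_3) (z : R).

(** Collecting powers of [x4] gives a normal form in which the coefficient of
    each power is a polynomial in the horizontal variables, so that identities
    valid for all [x4] can be read coefficient by coefficient. *)
Lemma tensorR_normal_form (K d : nat) (ja jb : int) f :
  ja + 1 = K%:Z -> jb + 1 = d%:Z ->
  tensorR T3 (P_T1 ja) (P jb T3) f ->
  exists c : nat -> mpoly 3 R, (forall j, (msize (c j) <= d)%N) /\
    forall x, N4 x -> f x = \sum_(j < K) x4 x ^+ j * ev (c j) (base x).
Proof.
move=> hK hd [m [a [b [ha hb hf]]]].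
have /choice[A hA] i : exists p : {poly R}, (size p <= K)%N /\
    forall z, T1 z -> a i z = p.[z].
  by have [p hp e] := ha i; exists p; split=> //; rewrite hK lez_nat in hp.
have /choice[B hB] i : exists p : mpoly 3 R, (msize p <= d)%N /\
    forall y, T3 y -> b i y = ev p y.
  by have [p hp e] := hb i; exists p; split=> //; rewrite hd lez_nat in hp.
exists (fun j => \sum_i (A i)`_j *: B i); split=> [j|x [x3 x1]].
  by apply: msize_sum_leq => i _; apply: msizeZ_leq; case: (hB i).
rewrite hf //; under [RHS]eq_bigr do rewrite raddf_sum mulr_sumr /=.
rewrite exchange_big; apply: eq_bigr => i _ /=.
have [sA ->] := hA i => //; have [_ ->] := hB i => //.
rewrite (horner_coef_wide _ sA) [LHS]mulr_suml; apply: eq_bigr => j _.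
by rewrite mevalZ mulrA [_ * x4 x ^+ j]mulrC.
Qed.

Lemma msize_homog j (p : mpoly 3 R) : p \is ishomog1 j mdeg -> (msize p <= j.+1)%N.
Proof.
move=> /allP h; rewrite mmeasureE; apply/bigmax_leqP_seq => m hm _.
by have /eqP -> := h _ hm.
Qed.

Lemma tensor_RT_normal_form k g :
  tensor T3 (P_T1 (k.+1%:Z - 1)) (RT k) g ->
  exists (p : nat -> 'I_3 -> mpoly 3 R) (s : nat -> mpoly 3 R),
    [/\ forall j c, (msize (p j c) <= k.+1)%N, forall j, (msize (s j) <= k.+1)%N &
    forall x, N4 x -> forall c, g x 0 c = \sum_(j < k.+1) x4 x ^+ j *
      (ev (p j c) (base x) + ev (s j) (base x) * base x 0 c)].
Proof.
move=> [m [a [b [ha hb hf]]]].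
have /choice[A hA] i : exists p : {poly R}, (size p <= k.+1)%N /\
    forall z, T1 z -> a i z = p.[z].
  by have [p hp e] := ha i; exists p; split=> //; rewrite subrK lez_nat in hp.
have /choice[B hB] i : exists ps : ('I_3 -> mpoly 3 R) * mpoly 3 R,
    [/\ forall c, (msize (ps.1 c) <= k.+1)%N, (msize ps.2 <= k.+1)%N &
    forall y c, T3 y -> b i y 0 c = ev (ps.1 c) y + ev ps.2 y * y 0 c].
  have [p [s [hp [s' hs es] e]]] := hb i.
  have /choice[p' hp'] c : exists p' : mpoly 3 R, (msize p' <= k.+1)%N /\
      forall y, T3 y -> p c y = ev p' y.
    by have [p' h1 h2] := hp c; exists p'; split=> //; move: h1; lia.
  exists (p', s'); split=> [c||y c Ty]; first by case: (hp' c).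
    exact: msize_homog.
  by rewrite e // !mxE es //; case: (hp' c) => _ ->.
exists (fun j c => \sum_i (A i)`_j *: (B i).1 c), (fun j => \sum_i (A i)`_j *: (B i).2).
split=> [j c|j|x [x3 x1] c].
- by apply: msize_sum_leq => i _; apply: msizeZ_leq; case: (hB i).
- by apply: msize_sum_leq => i _; apply: msizeZ_leq; case: (hB i).
rewrite hf // summxE.
under [RHS]eq_bigr do
  rewrite !raddf_sum /= mulr_suml -big_split mulr_sumr /=.
rewrite exchange_big; apply: eq_bigr => i _ /=; rewrite mxE.
have [sA ->] := hA i => //; have [_ _ ->] := hB i => //.
rewrite (horner_coef_wide _ sA) mulr_suml; apply: eq_bigr => j _.
by rewrite !mevalZ; ring.
Qed.

End NormalForms.

(** * Unisolvence *)

Section Unisolvence.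
Context {R : realType}.
Implicit Types (x : 'rV[R]_4) (y : 'rV[R]_3) (z : R).

(** Since [z^(j + 2) = z^j - (1 - z^2) z^j], an induction in steps of two divides
    the error of linear interpolation at the end points of [-1, 1] by the bubble
    [1 - z^2], with a quotient of degree at most [j - 2]. *)
Lemma expr_interpolation j : exists2 h : {poly R}, (size h <= j.-1)%N &
  forall z, z ^+ j = (1 + z) / 2 + (-1) ^+ j * ((1 - z) / 2) + (1 - z ^+ 2) * h.[z].
Proof.
suff [] : (exists2 h : {poly R}, (size h <= j.-1)%N & forall z,
    z ^+ j = (1 + z) / 2 + (-1) ^+ j * ((1 - z) / 2) + (1 - z ^+ 2) * h.[z])
  /\ (exists2 h : {poly R}, (size h <= j)%N & forall z,
    z ^+ j.+1 = (1 + z) / 2 + (-1) ^+ j.+1 * ((1 - z) / 2) + (1 - z ^+ 2) * h.[z])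
  by [].
elim: j => [|j [[h hs he] h1]].
  by split; exists 0; rewrite ?size_poly0 // => z; rewrite horner0; field.
split=> //; exists (h - 'X^j).
  rewrite (leq_trans (size_polyD _ _)) // size_polyN size_polyXn geq_max leqnn andbT.
  by apply: leq_trans hs _; rewrite (leq_trans (leq_pred _)).
move=> z; rewrite hornerD hornerN hornerXn.
rewrite (_ : z ^+ j.+2 = z ^+ j - (1 - z ^+ 2) * z ^+ j); last by rewrite !exprS; ring.
by rewrite {1}(he z) !exprS; field.
Qed.

Lemma horner_mpoly n (i : 'I_n) (h : {poly R}) :
  exists p : mpoly n R, forall x : 'rV[R]_n, ev p x = h.[x 0 i].
Proof.
exists (\sum_(j < size h) h`_j *: X i ^+ j) => x.
rewrite raddf_sum horner_coef; apply: eq_bigr => j _ /=.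
by rewrite mevalZ rmorphXn /= mevalXU.
Qed.

Lemma base_mpoly (p : mpoly 3 R) :
  exists p' : mpoly 4 R, forall x, ev p' x = ev p (base x).
Proof.
exists (comp_mpoly [tuple X (lshift 1 i) | i < 3] p) => x.
by rewrite ev_comp; apply: meval_eq => i; rewrite mxE tnth_mktuple mevalXU base_lshift.
Qed.

(** The end point values of the vertical component vanish by the tetrahedral
    facets, so it is [1 - z^2] times some [H], and [H] is the interior weight. *)
Lemma vertical_component_eq0 k (G : 'rV[R]_4 -> 'rV[R]_4) (c : nat -> mpoly 3 R) :
  (forall j, (msize (c j) <= k.+1)%N) ->
  (forall x, N4 x -> x4 (G x) = \sum_(j < k.+2) x4 x ^+ j * ev (c j) (base x)) ->
  dofs_vanish k.+1 G -> forall x, N4 x -> x4 (G x) = 0.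
Proof.
move=> hc Gc [tet _ _ inner].
have ends s : s = 1 \/ s = -1 -> forall y, \sum_(j < k.+2) s ^+ j * ev (c j) y = 0.
  move=> hs y; pose b := \sum_(j < k.+2) s ^+ j *: c j.
  have bE y' : ev b y' = \sum_(j < k.+2) s ^+ j * ev (c j) y'.
    by rewrite raddf_sum; apply: eq_bigr => j _; rewrite /= mevalZ.
  rewrite -bE; apply: (tet_facet_trace_eq0 hs _ _ (tet s hs)).
    by apply: msize_sum_leq => j _; apply: msizeZ_leq.
  move=> y' Ty'; rewrite Gc ?bE ?x4_pt ?base_pt //.
  by split; rewrite ?base_pt ?x4_pt // /T1 /=; case: hs => ->; lra.
have /choice[h hh] j : exists h : {poly R}, (size h <= j.-1)%N /\
    forall z, z ^+ j = (1 + z) / 2 + (-1) ^+ j * ((1 - z) / 2) + (1 - z ^+ 2) * h.[z].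
  by have [h h1 h2] := expr_interpolation j; exists h.
pose H x := \sum_(j < k.+2) (h j).[x4 x] * ev (c j) (base x).
have GH x : N4 x -> x4 (G x) = (1 - x4 x ^+ 2) * H x.
  move=> hx; have e1 : \sum_(j < k.+2) ev (c j) (base x) = 0.
    rewrite -[RHS](ends 1 (or_introl erefl) (base x)).
    by apply: eq_bigr => j _; rewrite expr1n mul1r.
  transitivity ((1 + x4 x) / 2 * (\sum_(j < k.+2) ev (c j) (base x))
    + (1 - x4 x) / 2 * (\sum_(j < k.+2) (-1) ^+ j * ev (c j) (base x))
    + (1 - x4 x ^+ 2) * H x).
    rewrite Gc // !mulr_sumr -!big_split; apply: eq_bigr => j _ /=.
    by rewrite {1}(proj2 (hh j) (x4 x)); ring.
  by rewrite e1 ends ?mulr0 ?add0r //; right.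
have Ht : tensorR T3 (P_T1 (k.+1%:Z - 2)) (P (k.+1%:Z - 1) T3) H.
  exists k.+2, (fun j z => (h j).[z]), (fun j y => ev (c j) y); split=> // j.
    exists (h j) => //; have := proj1 (hh j); have := ltn_ord j; lia.
  by exists (c j) => //; rewrite subrK lez_nat.
have /choice[hp hpE] j := @horner_mpoly 4 ord_max (h j).
have /choice[cp cpE] j := base_mpoly (c j).
pose Hp := \sum_(j < k.+2) hp j * cp j.
have HpE x : ev Hp x = H x.
  by rewrite raddf_sum; apply: eq_bigr => j _; rewrite /= mevalM hpE cpE.
pose u : mpoly 4 R := mpolyC 4 1 - X ord_max ^+ 2.
have uE x : ev u x = 1 - x4 x ^+ 2.
  by rewrite mevalB mevalC rmorphXn /= mevalXU.
have e x : N4 x -> dot (G x) (pt 0 (H x * theta (x4 x))) = ev (4^-1 *: (u * Hp) ^+ 2) x.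
  move=> hx; rewrite dot_base_x4 base_pt x4_pt dot3E !mxE !mulr0 !add0r GH //.
  by rewrite mevalZ rmorphXn /= mevalM uE HpE /theta /nu1 /nu2; field.
move=> x hx; rewrite GH // -uE -HpE -mevalM.
have : ev (4^-1 *: (u * Hp) ^+ 2) x = 0.
  apply: (N4_integral_eq0 e _ (inner H Ht)) => v hv.
  by rewrite e // mevalZ rmorphXn /= mulr_ge0 // sqr_ge0.
by rewrite mevalZ rmorphXn /= => /eqP; rewrite mulf_eq0 sqrf_eq0 gt_eqF //= => /eqP.
Qed.

(** The prism facets kill the normal traces, coefficient by coefficient in
    [x4]; the horizontal component is then itself an interior weight. *)
Lemma horizontal_component_eq0 k (G : 'rV[R]_4 -> 'rV[R]_4)
    (p : nat -> 'I_3 -> mpoly 3 R) (s : nat -> mpoly 3 R) :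
  (forall j c, (msize (p j c) <= k.+1)%N) -> (forall j, (msize (s j) <= k.+1)%N) ->
  (forall x, N4 x -> forall c, base (G x) 0 c = \sum_(j < k.+1) x4 x ^+ j *
      (ev (p j c) (base x) + ev (s j) (base x) * base x 0 c)) ->
  dofs_vanish k.+1 G -> forall x, N4 x -> base (G x) = 0.
Proof.
move=> hp hs Gp [_ prism inner _].
have trace (d : 'I_4) j y : (j < k.+1)%N -> lambda d y = 0 ->
    \sum_c (ev (p j c) y + ev (s j) y * y 0 c) * face_dir d 0 c = 0.
  (* [y] has a constant component along the normal on the plane of the face. *)
  pose beta : R := if d == 3 :> nat then -1 else 1.
  have dE y' : lambda d y' = 0 -> \sum_c y' 0 c * face_dir d 0 c = beta.
    rewrite sum3 lambdaE /beta.
    by case: d {beta} => [[|[|[|[|//]]]] hd]; rewrite !mxE /=; lra.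
  pose t i := \sum_c face_dir d 0 c *: p i c + beta *: s i.
  have tE i y' : lambda d y' = 0 -> ev (t i) y' =
      \sum_c (ev (p i c) y' + ev (s i) y' * y' 0 c) * face_dir d 0 c.
    move=> /dE h; rewrite mevalD raddf_sum mevalZ -h mulr_suml -big_split /=.
    by apply: eq_bigr => c _; rewrite mevalZ; ring.
  move=> jk ly; rewrite -tE //.
  apply: (prism_facet_trace_eq0 (G := G) (k := k.+1) _ _ (prism d) jk ly) => [i|y' z [Ty' ly'] Tz].
    by rewrite msizeD_leq ?msizeZ_leq // msize_sum_leq // => c _; rewrite msizeZ_leq.
  rewrite dot_base_x4 base_pt x4_pt mulr0 addr0 /dot.
  have hN : N4 (pt y' z) by split; rewrite ?base_pt ?x4_pt.
  under eq_bigr => c _ do rewrite (Gp _ hN) base_pt x4_pt mulr_suml.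
  rewrite exchange_big; apply: eq_bigr => i _ /=; rewrite tE // mulr_sumr.
  by apply: eq_bigr => c _; rewrite mulrA.
have /choice[q hq] j : exists q : 'I_3 -> mpoly 3 R, (forall r, (msize (q r) <= k)%N) /\
    ((j < k.+1)%N -> forall y, (\row_c ev (p j c) y) + ev (s j) y *: y =
      \sum_r (ev (q r) y * Psi r y) *: NN r y).
  (* Zero is a default value for the indices that the sums below do not reach. *)
  have [jk|jk] := ltnP j k.+1; last by exists (fun=> 0); split=> // r; rewrite msize0.
  have [||q [hq e]] := @RT_bubble_span R (p j) (s j) k (hp j) (hs j).
  - move=> c y yc.
    have := trace (lift ord_max c) j y jk; rewrite lambdaE sum3 lift_max.
    by elim/ord3_cases: c yc => yc; rewrite !mxE /= => h; lra.
  - move=> y hy; have := trace ord_max j y jk; rewrite lambdaE /= hy.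
    rewrite addrN mul0r oppr0 => h; rewrite -[RHS](h erefl); apply: eq_bigr => c _.
    by rewrite mxE /= mulr1.
  - by exists q.
pose Q (r : 'I_3) x := \sum_(j < k.+1) x4 x ^+ j * ev (q j r) (base x).
have Qt r : tensorR T3 (P_T1 (k.+1%:Z - 1)) (P (k.+1%:Z - 2) T3) (Q r).
  exists k.+1, (fun j z => z ^+ j), (fun j y => ev (q j r) y); split=> // j.
    by exists 'X^j => [|z _]; rewrite ?subrK ?lez_nat ?size_polyXn // hornerXn.
  by exists (q j r) => //; have := proj1 (hq j) r; lia.
have GQ x : N4 x -> base (G x) =
    \sum_r (Q r x * Psi r (base x)) *: NN r (base x).
  move=> hx; transitivity (\sum_(j < k.+1) x4 x ^+ j *:
      ((\row_c ev (p j c) (base x)) + ev (s j) (base x) *: base x)).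
    by apply/rowP => c; rewrite Gp // summxE; apply: eq_bigr => j _; rewrite !mxE.
  under eq_bigr => j _ do rewrite (proj2 (hq j) (ltn_ord j)) scaler_sumr.
  rewrite exchange_big; apply: eq_bigr => r _ /=.
  rewrite mulr_suml scaler_suml; apply: eq_bigr => j _.
  by rewrite scalerA mulrA.
have /choice[pp ppE] (jc : nat * 'I_3) := base_mpoly (p jc.1 jc.2).
have /choice[sp spE] j := base_mpoly (s j).
pose g c := \sum_(j < k.+1) X ord_max ^+ j * (pp (j : nat, c) + sp j * X (lshift 1 c)).
have gE x c : N4 x -> ev (g c) x = base (G x) 0 c.
  move=> hx; rewrite Gp // raddf_sum; apply: eq_bigr => j _ /=.
  rewrite mevalM rmorphXn /= mevalD mevalM ppE spE !mevalXU /=.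
  by rewrite base_lshift.
have e x : N4 x -> dot (G x) (\sum_r (Q r x * Psi r (base x)) *: pt (NN r (base x)) 0)
    = ev (\sum_c g c ^+ 2) x.
  move=> hx; have -> : \sum_r (Q r x * Psi r (base x)) *: pt (NN r (base x)) 0
      = pt (base (G x)) 0.
    by rewrite GQ // !sum3 -!ptZ -!ptD !mulr0 !addr0.
  rewrite dot_base_x4 base_pt x4_pt mulr0 addr0 raddf_sum; apply: eq_bigr => c _ /=.
  by rewrite rmorphXn /= gE // expr2.
move=> x hx; apply/rowP => c; rewrite [RHS]mxE -gE //.
have g0 v : 0 <= ev (\sum_c g c ^+ 2) v.
  by rewrite raddf_sum sumr_ge0 // => i _; rewrite /= rmorphXn sqr_ge0.
have : ev (\sum_c g c ^+ 2) x = 0.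
  by apply: (N4_integral_eq0 e _ (inner Q Qt)) => v hv; rewrite e.
rewrite raddf_sum /= => /eqP; rewrite psumr_eq0; last first.
  by move=> i _; rewrite rmorphXn sqr_ge0.
by move=> /allP/(_ c (mem_index_enum _)); rewrite rmorphXn /= sqrf_eq0 => /eqP.
Qed.

End Unisolvence.

Theorem lemma5p4 (R : realType) (k : nat) (hk : (1 <= k)%N)
  (G : 'rV[R]_4 -> 'rV[R]_4) (GV : VLambda3 k G) (Gdofs : dofs_vanish k G) :
  forall x, N4 x -> G x = 0.
Proof.
case: k hk GV Gdofs => // k _ [f [g [hf hg hG]]] dofs.
have [||c [hc fE]] := @tensorR_normal_form R k.+2 k.+1 _ _ f _ _ hf; [lia|lia|].
have [p [s [hp hs gE]]] := tensor_RT_normal_form hg.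
have GE x : N4 x -> G x = pt (g x) (f x).
  by move=> hx; rewrite hG // -ptD add0r addr0.
move=> x hx; rewrite -[LHS]pt_base_x4.
rewrite (vertical_component_eq0 hc _ dofs hx); last first.
  by move=> v hv; rewrite GE // x4_pt fE.
rewrite (horizontal_component_eq0 hp hs _ dofs hx); last first.
  by move=> v hv i; rewrite GE // base_pt gE.
by rewrite -(scale0r (pt 0 0)) -ptZ scale0r mul0r.
Qed.
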